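(* Let $k\ge 1$ be an integer. The minimal desingularization $\mathbb{D}(1,2,2k+1)$ of the weighted projective plane $\mathbb{P}(1,2,2k+1)$ is the complete toric surface whose fan $\Delta$ in $\mathbb{Z}^2$ has rays generated by $$\Delta(1)=\left\{\begin{bmatrix}1\\ 0\end{bmatrix},\begin{bmatrix}0\\ 1\end{bmatrix},\begin{bmatrix}-1\\ -k\end{bmatrix},\begin{bmatrix}-2\\ -(2k+1)\end{bmatrix},\begin{bmatrix}-1\\ -(k+1)\end{bmatrix},\begin{bmatrix}0\\ -1\end{bmatrix}\right\}.$$
   Context: Let $e_1,e_2$ be the standard basis of $\mathbb{Z}^2$. For relatively prime positive integers $m<n$, $\mathbb{P}(1,m,n)$ is the complete toric surface whose fan in $\mathbb{Z}^2$ has rays generated by $u_1=e_1$, $u_2=e_2$, $u_0=-me_1-ne_2$, the maximal cones being $\sigma_i$ ($i=0,1,2$), where $\sigma_i$ is generated by the two vectors $u_j$ with $j\ne i$. A complete fan in $\mathbb{Z}^2$ is determined by its set $\Delta(1)$ of primitive ray generators: the maximal cones are spanned by pairs of angularly adjacent rays. A two-dimensional cone with primitive generators $v,w$ is non-singular iff $\det|v\; w|=\pm1$. The minimal desingularization of a toric surface is the toric surface given by the coarsest refinement of its fan (fewest rays) all of whose cones are non-singular; for $\mathbb{P}(1,m,n)$ it is denoted $\mathbb{D}(1,m,n)$. *)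

(* Defs.v *)
From mathcomp Require Import all_boot all_order all_algebra.
From mathcomp Require Import all_classical all_reals.

Set Implicit Arguments.
Unset Strict Implicit.
Unset Printing Implicit Defensive.

Import Order.TTheory GRing.Theory Num.Theory.
Local Open Scope classical_set_scope.
Local Open Scope ring_scope.

(* Lattice vectors are columns in N = Z^2; cones are subsets of N_R = R^2. *)

Definition vec2 (x y : int) : 'cV[int]_2 := \col_(i < 2) [:: x; y]`_i.

Definition primitive (v : 'cV[int]_2) : bool := coprimez (v 0 0) (v 1 0).

Definition det2 (v w : 'cV[int]_2) : int := \det (row_mx v w : 'M[int]_2).

Definition cone (R : realType) (s : seq 'cV[int]_2) : set 'cV[R]_2 :=
  [set x | exists2 c : 'I_(size s) -> R, (forall i, 0 <= c i)
    & x = \sum_(i < size s) c i *: map_mx intr s`_i].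
Arguments cone R s x : clear implicits.

Definition strongly_convex (R : realType) (sigma : set 'cV[R]_2) : Prop :=
  forall x, sigma x -> sigma (- x) -> x = 0.

Definition face (R : realType) (tau sigma : set 'cV[R]_2) : Prop :=
  exists2 u : 'rV[R]_2, (forall x, sigma x -> 0 <= (u *m x) 0 0)
    & tau = sigma `&` [set x | (u *m x) 0 0 = 0].

Record is_fan (R : realType) (F : set (set 'cV[R]_2)) : Prop := IsFan {
  fan_finite : finite_set F;
  fan_polyhedral : forall sigma, F sigma -> exists s, sigma = cone R s;
  fan_strongly_convex : forall sigma, F sigma -> strongly_convex sigma;
  fan_face : forall sigma tau, F sigma -> face tau sigma -> F tau;
  fan_inter : forall sigma tau, F sigma -> F tau ->
    face (sigma `&` tau) sigma /\ face (sigma `&` tau) tau }.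

Definition fan_support (R : realType) (F : set (set 'cV[R]_2)) : set 'cV[R]_2 :=
  \bigcup_(sigma in F) sigma.

Definition is_complete_fan (R : realType) (F : set (set 'cV[R]_2)) : Prop :=
  is_fan F /\ fan_support F = setT.

Definition rays (R : realType) (F : set (set 'cV[R]_2)) : set 'cV[int]_2 :=
  [set v | primitive v /\ F (cone R [:: v])].

(* Only two-dimensional cones impose a condition: the zero cone and the rays
   are always non-singular. *)
Definition nonsingular_cone (R : realType) (sigma : set 'cV[R]_2) : Prop :=
  forall v w, primitive v -> primitive w -> det2 v w != 0 ->
    sigma = cone R [:: v; w] -> `|det2 v w| = 1.

Definition nonsingular_fan (R : realType) (F : set (set 'cV[R]_2)) : Prop :=
  forall sigma, F sigma -> nonsingular_cone sigma.

Definition refines (R : realType) (G F : set (set 'cV[R]_2)) : Prop :=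
  fan_support G = fan_support F /\
  forall tau, G tau -> exists2 sigma, F sigma & tau `<=` sigma.

Definition is_desingularization (R : realType)
    (F G : set (set 'cV[R]_2)) : Prop :=
  [/\ is_fan G, refines G F & nonsingular_fan G].

Definition is_minimal_desingularization (R : realType)
    (F G : set (set 'cV[R]_2)) : Prop :=
  [/\ is_desingularization F G,
      forall G', is_desingularization F G' -> refines G' G
    & forall G', is_desingularization F G' -> (rays G #<= rays G')%card].

Definition wps_ray (m n : nat) (i : 'I_3) : 'cV[int]_2 :=
  [:: vec2 (- m%:Z) (- n%:Z); vec2 1 0; vec2 0 1]`_i.

Definition wps_maxcone (R : realType) (m n : nat) (i : 'I_3) : set 'cV[R]_2 :=
  cone R [seq wps_ray m n j | j <- enum 'I_3 & j != i].
Arguments wps_maxcone R m n i x : clear implicits.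

(* The fan of P(1,m,n), meaningful for coprime positive m and n. *)
Definition wps_fan (R : realType) (m n : nat) : set (set 'cV[R]_2) :=
  [set tau | exists i : 'I_3, face tau (wps_maxcone R m n i)].
Arguments wps_fan R m n tau : clear implicits.

(* Main.v *)
(* Cones are handled through the cross product det(x, y): a strongly convex
   rational cone in the plane is 0, a ray, or [a; b] with det(a, b) > 0, and the
   last is cut out by det(a, x) >= 0 and det(x, b) >= 0. If an open sector (a, b)
   meets a cone [c; d] but contains neither c nor d, then [a; b] lies in [c; d].
   Hence the cones spanned by adjacent members of a finite set of primitive
   vectors form a fan, and a complete fan whose rays include those of another one
   refines it; since fans refining each other are equal, a complete fan is
   determined by its rays.

   The six listed vectors are exactly the irreducible lattice vectors of the
   maximal cones of P(1,2,2k+1). An irreducible vector of a cone of the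
   original fan cannot lie inside a nonsingular cone of a refinement, as it would
   be a sum of two nonzero lattice vectors there; so it spans a ray of every
   desingularization, and every desingularization refines the fan on the six. *)

Require Import Defs.
From mathcomp Require Import all_boot all_order all_algebra.
From mathcomp Require Import all_classical all_reals.
From mathcomp Require Import zify ring lra.

Set Implicit Arguments.
Unset Strict Implicit.
Unset Printing Implicit Defensive.

Import Order.TTheory GRing.Theory Num.Theory.
Local Open Scope classical_set_scope.
Local Open Scope ring_scope.

Local Notation toR v := (map_mx intr v).

(** * Cross products and primitive vectors *)

(** Stated over any commutative ring, so that the same identities serve lattice vectors and their
    real images. *)
Definition cross (A : comPzRingType) (x y : 'cV[A]_2) : A :=
  x 0 0 * y 1 0 - x 1 0 * y 0 0.

Lemma colv2P (A : Type) (x y : 'cV[A]_2) :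
  x 0 0 = y 0 0 -> x 1 0 = y 1 0 -> x = y.
Proof.
move=> h0 h1; apply/matrixP => i j; rewrite (ord1 j) {j}.
case: i => [[|[|//]] hi].
  by have -> : Ordinal hi = 0 by apply/val_inj.
by have -> : Ordinal hi = 1 by apply/val_inj.
Qed.

Lemma crossC (A : comPzRingType) (x y : 'cV[A]_2) : cross x y = - cross y x.
Proof. by rewrite /cross; ring. Qed.

Lemma crossxx (A : comPzRingType) (x : 'cV[A]_2) : cross x x = 0.
Proof. by rewrite /cross; ring. Qed.

Lemma crossDr (A : comPzRingType) (x y z : 'cV[A]_2) :
  cross x (y + z) = cross x y + cross x z.
Proof. by rewrite /cross !mxE; ring. Qed.

Lemma crossDl (A : comPzRingType) (x y z : 'cV[A]_2) :
  cross (y + z) x = cross y x + cross z x.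
Proof. by rewrite /cross !mxE; ring. Qed.

Lemma crossZr (A : comPzRingType) (x y : 'cV[A]_2) a :
  cross x (a *: y) = a * cross x y.
Proof. by rewrite /cross !mxE; ring. Qed.

Lemma crossZl (A : comPzRingType) (x y : 'cV[A]_2) a :
  cross (a *: y) x = a * cross y x.
Proof. by rewrite /cross !mxE; ring. Qed.

Lemma crossNr (A : comPzRingType) (x y : 'cV[A]_2) : cross x (- y) = - cross x y.
Proof. by rewrite /cross !mxE; ring. Qed.

Lemma crossNl (A : comPzRingType) (x y : 'cV[A]_2) : cross (- x) y = - cross x y.
Proof. by rewrite /cross !mxE; ring. Qed.

Lemma cross0r (A : comPzRingType) (x : 'cV[A]_2) : cross x 0 = 0.
Proof. by rewrite /cross !mxE; ring. Qed.

Lemma cross0l (A : comPzRingType) (x : 'cV[A]_2) : cross 0 x = 0.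
Proof. by rewrite /cross !mxE; ring. Qed.

(** Cramer's rule without division, hence usable over [int]: up to the factor [cross a b], the
    coordinates of [x] in the basis [a], [b] are cross products. *)
Lemma cramer2 (A : comPzRingType) (a b x : 'cV[A]_2) :
  cross a b *: x = cross x b *: a + cross a x *: b.
Proof. by apply: colv2P; rewrite /cross !mxE; ring. Qed.

(** The Plücker relation. The left side is the determinant of the Cramer coordinates of [c] and [d]
    in the basis [a], [b]. *)
Lemma cross_pluecker (A : comPzRingType) (a b c d : 'cV[A]_2) :
  cross c b * cross a d - cross a c * cross d b = cross a b * cross c d.
Proof. by rewrite /cross; ring. Qed.

Lemma det_mx2 (A : comPzRingType) (M : 'M[A]_2) :
  \det M = M 0 0 * M 1 1 - M 0 1 * M 1 0.
Proof.
rewrite (expand_det_row _ 0) !big_ord_recl big_ord0 /cofactor !det_mx11 !mxE.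
have -> : lift 0 0 = 1 :> 'I_2 by apply/val_inj.
have -> : lift 1 0 = 0 :> 'I_2 by apply/val_inj.
rewrite /= expr0 expr1; ring.
Qed.

Lemma det2E v w : det2 v w = cross v w.
Proof.
rewrite /det2 det_mx2 /cross.
have h (i : 'I_2) : row_mx v w i 0 = v i 0.
  have -> : 0 = lshift 1 0 :> 'I_(1 + 1) by apply/val_inj.
  by rewrite row_mxEl.
have h' (i : 'I_2) : row_mx v w i 1 = w i 0.
  have -> : 1 = rshift 1 0 :> 'I_(1 + 1) by apply/val_inj.
  by rewrite row_mxEr.
by rewrite !h !h'; ring.
Qed.

Lemma cross_toR (R : realType) (v w : 'cV[int]_2) :
  cross (toR v) (toR w) = (cross v w)%:~R :> R.
Proof. by rewrite /cross !mxE -!rmorphM -rmorphB. Qed.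

Lemma toR_inj (R : realType) : injective (fun v : 'cV[int]_2 => toR v : 'cV[R]_2).
Proof.
by move=> v w /matrixP h; apply/matrixP => i j; have := h i j; rewrite !mxE => /intr_inj.
Qed.

(** Bezout coefficients of the coordinates, turned by a quarter, complete [v] to a basis of the
    lattice. *)
Lemma primitiveP (v : 'cV[int]_2) :
  reflect (exists w : 'cV[int]_2, cross v w = 1) (primitive v).
Proof.
apply: (iffP (coprimezP _ _)) => [[[p q] /= h]|[w h]].
  exists (vec2 (- q) p); rewrite /cross !mxE /= -h; ring.
exists (w 1 0, - w 0 0) => /=; rewrite -h /cross; ring.
Qed.

Lemma primitive_neq0 v : primitive v -> v != 0.
Proof. by case/primitiveP=> w h; apply/eqP => v0; move: h; rewrite v0 cross0l. Qed.

Lemma primitive_collinear (v w : 'cV[int]_2) :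
  primitive v -> cross v w = 0 -> exists c, w = c *: v.
Proof.
case/primitiveP => u h h0; exists (cross w u).
by have := cramer2 v u w; rewrite h h0 scale1r scale0r addr0.
Qed.

Lemma primitive_collinear2 (v w : 'cV[int]_2) :
  primitive v -> primitive w -> cross v w = 0 -> w = v \/ w = - v.
Proof.
move=> pv pw h; have [c ec] := primitive_collinear pv h.
case/primitiveP: pw => u; rewrite ec crossZl => hc.
have : c = 1 \/ c = - 1.
  have : absz (c * cross v u) = 1%N by rewrite hc.
  by rewrite abszM => /eqP; rewrite muln_eq1 => /andP[/eqP h1 _]; lia.
by case=> ->; rewrite ?scaleN1r ?scale1r; [left | right].
Qed.

Lemma primitive_part (v : 'cV[int]_2) : v != 0 ->
  exists g w, [/\ 0 < g :> int, primitive w & v = g *: w].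
Proof.
move=> v0; set g := gcdz (v 0 0) (v 1 0).
have g0 : g != 0.
  apply: contra v0; rewrite gcdz_eq0 => /andP[/eqP h0 /eqP h1].
  by apply/eqP/colv2P; rewrite !mxE.
have gp : 0 < g by rewrite lt_def g0.
have [p ep] := dvdzP (dvdz_gcdl (v 0 0) (v 1 0)).
have [q eq] := dvdzP (dvdz_gcdr (v 0 0) (v 1 0)).
exists g, (vec2 p q); split=> //; last first.
  by apply: colv2P; rewrite !mxE /= mulrC.
have [s [t h]] := Bezoutz (v 0 0) (v 1 0).
apply/primitiveP; exists (vec2 (- t) s); rewrite /cross !mxE /=.
have {}h : s * (p * g) + t * (q * g) = g by rewrite -ep -eq.
by apply: (mulfI g0); rewrite mulr1 -[RHS]h; ring.
Qed.

(** * Cones and their faces *)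

Lemma cone_nil (R : realType) : cone R [::] = [set 0].
Proof.
apply/seteqP; split=> x /=; first by case=> c _ ->; rewrite big_ord0.
by move=> ->; exists (fun _ => 0) => //; rewrite big_ord0.
Qed.

(** Splitting off the first coefficient makes induction on the list of generators possible. *)
Lemma cone_cons (R : realType) v s (x : 'cV[R]_2) :
  cone R (v :: s) x <->
  exists a y, [/\ 0 <= a, cone R s y & x = a *: toR v + y].
Proof.
split=> [[c c0 ->]|[a [y [a0 [c c0 ->] ->]]]].
  exists (c ord0), (\sum_(i < size s) c (lift ord0 i) *: toR s`_i).
  split=> //; last by rewrite big_ord_recl.
  by exists (fun i => c (lift ord0 i)).
exists (fun i => if unlift ord0 i is Some j then c j else a).
  by move=> i; case: unliftP.
rewrite /= big_ord_recl unlift_none; congr (_ + _).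
by apply: eq_bigr => i _; rewrite liftK.
Qed.

Lemma cone1P (R : realType) v (x : 'cV[R]_2) :
  cone R [:: v] x <-> exists2 a, 0 <= a & x = a *: toR v.
Proof.
rewrite cone_cons; split=> [[a [y [a0]]]|[a a0 ->]].
  by rewrite cone_nil /= => -> ->; exists a; rewrite ?addr0.
by exists a, 0; rewrite cone_nil addr0.
Qed.

Lemma cone2P (R : realType) v w (x : 'cV[R]_2) :
  cone R [:: v; w] x <->
  exists a b, [/\ 0 <= a, 0 <= b & x = a *: toR v + b *: toR w].
Proof.
rewrite cone_cons; split=> [[a [y [a0 /cone1P[b b0 ->] ->]]]|[a [b [a0 b0 ->]]]].
  by exists a, b.
by exists a, (b *: toR w); split=> //; apply/cone1P; exists b.
Qed.

Lemma cone0 (R : realType) s : cone R s 0.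
Proof.
by exists (fun _ => 0) => //; rewrite big1 // => i _; rewrite scale0r.
Qed.

Lemma coneD (R : realType) s x y : cone R s x -> cone R s y -> cone R s (x + y).
Proof.
move=> [c c0 ->] [d d0 ->]; exists (fun i => c i + d i).
  by move=> i; rewrite addr_ge0.
by rewrite -big_split; apply: eq_bigr => i _; rewrite scalerDl.
Qed.

Lemma coneZ (R : realType) s a x : 0 <= a -> cone R s x -> cone R s (a *: x).
Proof.
move=> a0 [c c0 ->]; exists (fun i => a * c i).
  by move=> i; rewrite mulr_ge0.
by rewrite scaler_sumr; apply: eq_bigr => i _; rewrite scalerA.
Qed.

Lemma coneZ_iff (R : realType) s a x : 0 < a -> cone R s (a *: x) <-> cone R s x.
Proof.
move=> a0; split; last exact/coneZ/ltW.
move/(coneZ (s := s) (a := a^-1)); rewrite invr_ge0 (ltW a0) => /(_ isT).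
by rewrite scalerA mulVf ?lt0r_neq0 // scale1r.
Qed.

Lemma cone_sub (R : realType) s t :
  (forall v, v \in s -> cone R t (toR v)) -> cone R s `<=` cone R t.
Proof.
elim: s => [_|v s ih h]; first by rewrite cone_nil => x ->; exact: cone0.
move=> x /cone_cons[a [y [a0 hy ->]]]; apply: coneD.
  by apply: coneZ => //; apply: h; rewrite mem_head.
by apply: ih hy => w hw; apply: h; rewrite inE hw orbT.
Qed.

Lemma cone_gen (R : realType) s v : v \in s -> cone R s (toR v).
Proof.
elim: s => // w s ih; rewrite inE => /orP[/eqP ->|/ih h]; apply/cone_cons.
  by exists 1, 0; rewrite scale1r addr0; split=> //; exact: cone0.
by exists 0, (toR v); rewrite scale0r add0r.
Qed.

Lemma cone_eq_mem (R : realType) s t : s =i t -> cone R s = cone R t.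
Proof.
by move=> h; apply/seteqP; split; apply: cone_sub => v hv; apply: cone_gen;
  rewrite ?h // -h.
Qed.

Lemma cone2C (R : realType) v w : cone R [:: v; w] = cone R [:: w; v].
Proof. by apply: cone_eq_mem => u; rewrite !inE orbC. Qed.

(** The two cross products are the Cramer coordinates of [x] in the basis [v], [w], scaled by the
    positive number [cross v w]. *)
Lemma cone_crossP (R : realType) (v w : 'cV[int]_2) (x : 'cV[R]_2) :
  0 < cross v w ->
  cone R [:: v; w] x <-> 0 <= cross (toR v) x /\ 0 <= cross x (toR w).
Proof.
rewrite -(ltr0z R) -cross_toR => h; rewrite cone2P; split.
  move=> [a [b [a0 b0 ->]]].
  rewrite crossDr crossDl !crossZr !crossZl !crossxx.
  by rewrite !mulr0 add0r addr0; split; apply: mulr_ge0 => //; exact: ltW.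
move=> [h1 h2].
exists (cross x (toR w) / cross (toR v) (toR w)),
       (cross (toR v) x / cross (toR v) (toR w)).
split; rewrite ?divr_ge0 ?(ltW h) //.
apply: (scalerI (lt0r_neq0 h)); rewrite cramer2 scalerDr !scalerA.
by rewrite ![cross (toR v) (toR w) * _]mulrC !divfK ?lt0r_neq0.
Qed.

Lemma cone_cross_int (R : realType) (v w x : 'cV[int]_2) :
  0 < cross v w ->
  cone R [:: v; w] (toR x) <-> 0 <= cross v x /\ 0 <= cross x w.
Proof. by move=> h; rewrite cone_crossP // !cross_toR !ler0z. Qed.

Lemma cone_consE (R : realType) v s t :
  cone R s = cone R t -> cone R (v :: s) = cone R (v :: t).
Proof.
by move=> h; apply/seteqP; split=> x /cone_cons[a [y [a0 hy ->]]];
  apply/cone_cons; exists a, y; rewrite h in hy *.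
Qed.

Lemma cone_cons_mem (R : realType) v s :
  cone R s (toR v) -> cone R (v :: s) = cone R s.
Proof.
move=> h; apply/seteqP; split; apply: cone_sub => w.
  by rewrite inE => /predU1P[->|/(cone_gen R)].
by move=> hw; apply: cone_gen; rewrite inE hw orbT.
Qed.

Lemma toRZ (R : realType) g (v : 'cV[int]_2) :
  toR (g *: v) = g%:~R *: toR v :> 'cV[R]_2.
Proof. by apply: colv2P; rewrite !mxE rmorphM. Qed.

Lemma toRN (R : realType) (v : 'cV[int]_2) : toR (- v) = - toR v :> 'cV[R]_2.
Proof. by apply: colv2P; rewrite !mxE rmorphN. Qed.

Lemma toR0 (R : realType) : toR (0 : 'cV[int]_2) = 0 :> 'cV[R]_2.
Proof. by apply: colv2P; rewrite !mxE. Qed.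

Lemma toR_eq0 (R : realType) (v : 'cV[int]_2) : toR v = 0 :> 'cV[R]_2 -> v = 0.
Proof. by rewrite -toR0 => /toR_inj. Qed.

Lemma cone_consZ (R : realType) (g : int) v s : 0 < g ->
  cone R (g *: v :: s) = cone R (v :: s).
Proof.
move=> g0; apply/seteqP; split; apply: cone_sub => w;
  rewrite inE => /predU1P[->|hw]; try by apply: cone_gen; rewrite inE hw orbT.
  by rewrite toRZ coneZ_iff ?ltr0z //; apply: cone_gen; rewrite mem_head.
rewrite -(@coneZ_iff R _ g%:~R) ?ltr0z // -toRZ.
by apply: cone_gen; rewrite mem_head.
Qed.

Lemma strongly_convex_int (R : realType) s v : strongly_convex (cone R s) ->
  cone R s (toR v) -> cone R s (toR (- v)) -> v = 0.
Proof. by move=> sc h h'; apply/(@toR_eq0 R)/sc; rewrite -?toRN. Qed.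

(** Induction on the generators: the primitive part of each new one is absorbed by the cone built so
    far or becomes a new end of it, unless its opposite lies there, which strong convexity
    forbids. *)
Lemma strongly_convex_cone (R : realType) s : strongly_convex (cone R s) ->
  [\/ cone R s = cone R [::],
      exists2 v, primitive v & cone R s = cone R [:: v]
    | exists v w, [/\ primitive v, primitive w, 0 < cross v w
                    & cone R s = cone R [:: v; w]]].
Proof.
elim: s => [_|v s ih sc]; first by constructor 1.
have {}ih := ih _; have sc' : strongly_convex (cone R s).
  move=> x hx hx'; apply: sc; apply/cone_cons; exists 0.
    by exists x; rewrite scale0r add0r.
  by exists (- x); rewrite scale0r add0r.
have [->|/primitive_part[g [u [g0 pu ev]]]] := eqVneq v 0.
  by rewrite cone_cons_mem ?toR0 //; [exact: ih | exact: cone0].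
have ec t : cone R s = cone R t -> cone R (v :: s) = cone R (u :: t).
  by move=> h; rewrite ev cone_consZ // (cone_consE _ h).
case: (ih sc') => [/ec e|[w pw /ec e]|[a [b [pa pb ab /ec e]]]].
- by constructor 2; exists u.
- rewrite e in sc *; have [h|h|h] := ltgtP (cross u w) 0.
  + constructor 3; exists w, u; split=> //; last by rewrite cone2C.
    by rewrite crossC oppr_gt0.
  + by constructor 3; exists u, w.
  + have [ew|ew] := primitive_collinear2 pu pw h.
      constructor 2; exists u => //; rewrite ew cone_cons_mem //.
      by apply: cone_gen; rewrite mem_head.
    have u0 : u = 0.
      apply: (strongly_convex_int sc); apply: cone_gen; rewrite !inE ?eqxx //.
      by rewrite ew eqxx orbT.
    by move: (primitive_neq0 pu); rewrite u0 eqxx.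
rewrite e in sc *.
have u0 : u <> 0 by apply/eqP/primitive_neq0.
have mem w : w \in [:: u; a; b] -> cone R [:: u; a; b] (toR w) by exact: cone_gen.
have aM : cone R [:: u; a; b] (toR a) by apply: mem; rewrite !inE eqxx orbT.
have bM : cone R [:: u; a; b] (toR b) by apply: mem; rewrite !inE eqxx !orbT.
have uM : cone R [:: u; a; b] (toR u) by apply: mem; rewrite !inE eqxx.
(* By the two signs, [u] lies in the cone from [a] to [b], or past [b], or before [a], or [- u] lies
   inside. In the middle cases a zero cross product would make [u] equal to an end, against the
   other sign, or opposite to it, against strong convexity. *)
have [au|au] := leP 0 (cross a u); have [ub|ub] := leP 0 (cross u b).
- constructor 3; exists a, b; split=> //.
  by rewrite cone_cons_mem // cone_cross_int.
- have {}au : 0 < cross a u.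
    rewrite lt_def au andbT; apply/eqP => au0; apply: u0.
    have [h|h] := primitive_collinear2 pa pu au0; last first.
      by apply: (strongly_convex_int sc uM); have -> : - u = a by rewrite h opprK.
    by move: ub; rewrite h ltNge (ltW ab).
  constructor 3; exists a, u; split=> //.
  apply/seteqP; split; apply: cone_sub => w; rewrite !inE.
    move=> /or3P[]/eqP->; try by apply: cone_gen; rewrite !inE eqxx ?orbT.
    by rewrite cone_cross_int // (ltW ab) crossC oppr_ge0 ltW.
  by move=> /orP[]/eqP->.
- have {}ub : 0 < cross u b.
    rewrite lt_def ub andbT; apply/eqP => ub0; apply: u0.
    have [h|h] := primitive_collinear2 pu pb ub0; last first.
      by apply: (strongly_convex_int sc uM); have <- : b = - u by exact: h.
    by move: au; rewrite -h ltNge (ltW ab).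
  constructor 3; exists u, b; split=> //.
  apply/seteqP; split; apply: cone_sub => w; rewrite !inE.
    move=> /or3P[]/eqP->; try by apply: cone_gen; rewrite !inE eqxx ?orbT.
    by rewrite cone_cross_int // (ltW ab) crossC oppr_ge0 ltW.
  by move=> /orP[]/eqP->.
- case: u0; apply: (strongly_convex_int sc uM).
  have: cone R [:: a; b] (toR (- u)).
    by rewrite cone_cross_int // crossNr crossNl !oppr_ge0 !ltW.
  by apply: cone_sub => w; rewrite !inE => /orP[]/eqP->.
Qed.

Lemma cone1_inj (R : realType) v w : primitive v -> primitive w ->
  cone R [:: w] (toR v) -> v = w.
Proof.
move=> pv pw /cone1P[a a0 e].
have cr : cross w v = 0.
  by apply: (@intr_inj R); rewrite -cross_toR e crossZr crossxx mulr0.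
have [//|h] := primitive_collinear2 pw pv cr.
have : (a + 1) *: (toR w : 'cV[R]_2) = 0.
  by rewrite scalerDl -e h toRN scale1r addNr.
move/eqP; rewrite scaler_eq0 gt_eqF ?ltr_wpDl //= => /eqP /toR_eq0 w0.
by move: (primitive_neq0 pw); rewrite w0 eqxx.
Qed.

(** Each of [a] and [c] lies in the other's cone, so [cross a c] has both signs and vanishes;
    likewise for [b] and [d]. Opposite vectors are excluded by the remaining inequalities. *)
Lemma cone2_inj (R : realType) a b c d :
  primitive a -> primitive b -> primitive c -> primitive d ->
  0 < cross a b -> 0 < cross c d ->
  cone R [:: a; b] = cone R [:: c; d] -> a = c /\ b = d.
Proof.
move=> pa pb pc pd ab cd e.
have : cone R [:: c; d] (toR a) by rewrite -e; apply: cone_gen; rewrite !inE eqxx.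
have : cone R [:: c; d] (toR b) by rewrite -e; apply: cone_gen; rewrite !inE eqxx orbT.
have : cone R [:: a; b] (toR c) by rewrite e; apply: cone_gen; rewrite !inE eqxx.
have : cone R [:: a; b] (toR d) by rewrite e; apply: cone_gen; rewrite !inE eqxx orbT.
rewrite !cone_cross_int // => -[ad db] [ac cb] [cb' bd] [ca ad'].
have ac0 : cross a c = 0 by move: ac ca; rewrite (crossC c a); lia.
have bd0 : cross b d = 0 by move: bd db; rewrite (crossC d b); lia.
split.
  have [//|h] := primitive_collinear2 pa pc ac0.
  by move: cb; rewrite h crossNl; lia.
have [//|h] := primitive_collinear2 pb pd bd0.
by move: ad; rewrite h crossNr; lia.
Qed.

(** * Faces and supporting functionals *)

Definition cross_form (R : realType) (a : 'cV[R]_2) : 'rV[R]_2 :=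
  \row_j [:: - a 1 0; a 0 0]`_j.

Lemma cross_formE (R : realType) (a x : 'cV[R]_2) :
  (cross_form a *m x) 0 0 = cross a x.
Proof.
rewrite mxE !big_ord_recl big_ord0 !mxE /= /cross.
have -> : lift ord0 ord0 = 1 :> 'I_2 by apply/val_inj.
have -> : ord0 = 0 :> 'I_2 by apply/val_inj.
ring.
Qed.

Lemma face_sub (R : realType) (tau sigma : set 'cV[R]_2) :
  face tau sigma -> tau `<=` sigma.
Proof. by case=> u _ -> x []. Qed.

Lemma face_refl (R : realType) (sigma : set 'cV[R]_2) : face sigma sigma.
Proof.
exists 0 => [x _|]; first by rewrite mul0mx mxE.
by apply/seteqP; split=> x; [move=> hx; split=> //=; rewrite mul0mx mxE | case].
Qed.

(** A functional that is nonnegative on the generators kills a nonnegative combination only if it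
    kills every generator with a nonzero coefficient. So the face is spanned by the generators that
    it kills. *)
Lemma face_cone (R : realType) s (tau : set 'cV[R]_2) : face tau (cone R s) ->
  exists p, tau = cone R [seq v <- s | p v].
Proof.
case=> u u0 ->; exists (fun v => (u *m toR v) 0 0 == 0).
have lin a (v : 'cV[int]_2) y : (u *m (a *: toR v + y)) 0 0
    = a * (u *m toR v) 0 0 + (u *m y) 0 0 :> R.
  by rewrite mulmxDr -scalemxAr !mxE.
apply/seteqP; split=> x /=; last first.
  move=> hx; split.
    by apply: cone_sub hx => v; rewrite mem_filter => /andP[_]; exact: cone_gen.
  elim: s {u0} x hx => [|v s ih] x /=.
    by rewrite cone_nil => ->; rewrite mulmx0 mxE.
  case: eqP => [v0|_]; last exact: ih.
  by move=> /cone_cons[a [y [a0 /ih hy ->]]]; rewrite lin v0 hy mulr0 addr0.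
case=> hx; elim: s u0 x hx => [|v s ih] u0 x; first by [].
have us y : cone R s y -> 0 <= (u *m y) 0 0.
  by move=> hy; apply: u0; apply/cone_cons; exists 0, y; rewrite scale0r add0r.
have uv : 0 <= (u *m toR v) 0 0 by apply/u0/cone_gen; rewrite mem_head.
move=> /cone_cons[a [y [a0 hy ->]]] /eqP; rewrite lin paddr_eq0 ?(us y hy) ?mulr_ge0 //.
move=> /andP[av /eqP/(ih us y hy) {}hy] /=.
have [v0|v0] := eqVneq; first by apply/cone_cons; exists a, y.
by move: av; rewrite mulf_eq0 (negPf v0) orbF => /eqP->; rewrite scale0r add0r.
Qed.

Lemma face_cone1 (R : realType) v (tau : set 'cV[R]_2) :
  face tau (cone R [:: v]) -> tau = cone R [::] \/ tau = cone R [:: v].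
Proof. by case/face_cone => p ->; rewrite /=; case: (p v); [right | left]. Qed.

Lemma face_cone2 (R : realType) v w (tau : set 'cV[R]_2) :
  face tau (cone R [:: v; w]) ->
  [\/ tau = cone R [::], tau = cone R [:: v], tau = cone R [:: w]
    | tau = cone R [:: v; w]].
Proof.
by case/face_cone => p ->; rewrite /=; case: (p v); case: (p w);
  [constructor 4 | constructor 2 | constructor 3 | constructor 1].
Qed.

Lemma cone2_face_left (R : realType) v w : 0 < cross v w ->
  face (cone R [:: v]) (cone R [:: v; w]).
Proof.
move=> vw; have vwR : 0 < cross (toR v) (toR w) :> R by rewrite cross_toR ltr0z.
exists (cross_form (toR v)) => [x /(cone_crossP _ vw)[]|].
  by rewrite cross_formE.
apply/seteqP; split=> x /=; rewrite cross_formE.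
  move=> /cone1P[a a0 ->]; rewrite crossZr crossxx mulr0; split=> //.
  by apply/cone2P; exists a, 0; rewrite scale0r addr0.
move=> [/cone2P[a [b [a0 b0 ->]]]].
rewrite crossDr !crossZr crossxx mulr0 add0r => /eqP.
rewrite mulf_eq0 (gt_eqF vwR) orbF => /eqP->.
by rewrite scale0r addr0; apply/cone1P; exists a.
Qed.

Lemma cone2_face_right (R : realType) v w : 0 < cross v w ->
  face (cone R [:: w]) (cone R [:: v; w]).
Proof.
move=> vw; have vwR : 0 < cross (toR v) (toR w) :> R by rewrite cross_toR ltr0z.
exists (cross_form (- toR w)) => [x /(cone_crossP _ vw)[]|].
  by rewrite cross_formE crossNl -crossC.
apply/seteqP; split=> x /=; rewrite cross_formE crossNl -crossC.
  move=> /cone1P[a a0 ->]; rewrite crossZl crossxx mulr0; split=> //.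
  by apply/cone2P; exists 0, a; rewrite scale0r add0r.
move=> [/cone2P[a [b [a0 b0 ->]]]].
rewrite crossDl !crossZl crossxx mulr0 addr0 => /eqP.
rewrite mulf_eq0 (gt_eqF vwR) orbF => /eqP->.
by rewrite scale0r add0r; apply/cone1P; exists b.
Qed.

Lemma cone0_face1 (R : realType) v : primitive v ->
  face (cone R [::]) (cone R [:: v]).
Proof.
case/primitiveP=> w vw; have vwR : cross (toR v) (toR w) = 1 :> R.
  by rewrite cross_toR vw.
(* With [w] completing [v] to a basis, this functional sends [a *: toR v] to [a]. *)
exists (cross_form (- toR w)) => [x /cone1P[a a0 ->]|].
  by rewrite cross_formE crossNl -crossC crossZl vwR mulr1.
rewrite cone_nil; apply/seteqP; split=> x /=; rewrite cross_formE.
  by move=> ->; rewrite cross0r; split=> //; exact: cone0.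
rewrite crossNl -crossC.
move=> [/cone1P[a a0 ->]]; rewrite crossZl vwR mulr1 => ->.
by rewrite scale0r.
Qed.

Lemma cone0_face2 (R : realType) v w : 0 < cross v w ->
  face (cone R [::]) (cone R [:: v; w]).
Proof.
move=> vw; have vwR : 0 < cross (toR v) (toR w) :> R by rewrite cross_toR ltr0z.
(* The sum of the two functionals that bound the cone; on the cone it vanishes only where both
   do. *)
exists (cross_form (toR v - toR w)) => [x /(cone_crossP _ vw)[h1 h2]|].
  by rewrite cross_formE crossDl crossNl -crossC addr_ge0.
rewrite cone_nil; apply/seteqP; split=> x /=; rewrite cross_formE.
  by move=> ->; rewrite cross0r; split=> //; exact: cone0.
rewrite crossDl crossNl -crossC.
move=> [/(cone_crossP _ vw)[h1 h2] /eqP]; rewrite paddr_eq0 // => /andP[/eqP e1 /eqP e2].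
apply: (scalerI (lt0r_neq0 vwR)).
by rewrite cramer2 e1 e2 !scale0r addr0 scaler0.
Qed.

(** Here x is in the open first quadrant and in the cone from c to d, with c and d outside that
    quadrant. If c1 were negative, so would be c2, and writing det(c, d) x as det(x, d) c + det(c,
    x) d would force d into the open quadrant. Once c1 is nonnegative, a positive c2 would put c
    there. *)
Lemma sector_coords (R : realFieldType) (x1 x2 c1 c2 d1 d2 : R) :
  0 < x1 -> 0 < x2 -> 0 < c1 * d2 - c2 * d1 ->
  0 <= c1 * x2 - c2 * x1 -> 0 <= x1 * d2 - x2 * d1 ->
  ~ (0 < c1 /\ 0 < c2) -> ~ (0 < d1 /\ 0 < d2) -> 0 <= c1 /\ c2 <= 0.
Proof.
move=> x1p x2p cd cx xd nc nd.
have c1p : 0 <= c1.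
  rewrite leNgt; apply/negP => c1n; apply: nd.
  have c2n : c2 < 0.
    have h : c1 * x2 < 0 by rewrite pmulr_llt0.
    by rewrite -(pmulr_llt0 _ x1p); lra.
  have e1 : x1 * (c1 * d2 - c2 * d1)
      = (x1 * d2 - x2 * d1) * c1 + (c1 * x2 - c2 * x1) * d1 by ring.
  have e2 : x2 * (c1 * d2 - c2 * d1)
      = (x1 * d2 - x2 * d1) * c2 + (c1 * x2 - c2 * x1) * d2 by ring.
  have p1 : 0 < x1 * (c1 * d2 - c2 * d1) by rewrite mulr_gt0.
  have p2 : 0 < x2 * (c1 * d2 - c2 * d1) by rewrite mulr_gt0.
  have q1 : (x1 * d2 - x2 * d1) * c1 <= 0 by rewrite mulr_ge0_le0 // ltW.
  have q2 : (x1 * d2 - x2 * d1) * c2 <= 0 by rewrite mulr_ge0_le0 // ltW.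
  by split; rewrite ltNge; apply/negP => dn;
    have := mulr_ge0_le0 cx dn; lra.
split=> //; rewrite leNgt; apply/negP => c2p; apply: nc; split=> //.
have h : 0 < c2 * x1 by rewrite mulr_gt0.
by rewrite -(pmulr_lgt0 _ x2p); lra.
Qed.

(* Up to the common factor [cross a b], the numbers c1, c2 and d1, d2 of
   [sector_coords] are the coordinates of c and d in the basis a, b. *)
Lemma sector_sub (R : realType) (a b c d : 'cV[int]_2) (x : 'cV[R]_2) :
  0 < cross a b -> 0 < cross c d ->
  0 < cross (toR a) x -> 0 < cross x (toR b) -> cone R [:: c; d] x ->
  ~~ ((0 < cross a c) && (0 < cross c b)) ->
  ~~ ((0 < cross a d) && (0 < cross d b)) ->
  cone R [:: a; b] `<=` cone R [:: c; d].
Proof.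
move=> ab cd ax xb /(cone_crossP _ cd)[cx xd] nc nd.
have abR : 0 < cross (toR a) (toR b) :> R by rewrite cross_toR ltr0z.
have cdR : 0 < cross (toR c) (toR d) :> R by rewrite cross_toR ltr0z.
pose c1 := cross (toR c) (toR b) : R; pose c2 := cross (toR a) (toR c) : R.
pose d1 := cross (toR d) (toR b) : R; pose d2 := cross (toR a) (toR d) : R.
have h1 : 0 < c1 * d2 - c2 * d1 by rewrite cross_pluecker mulr_gt0.
have h2 : 0 <= c1 * cross (toR a) x - c2 * cross x (toR b).
  by rewrite cross_pluecker mulr_ge0 // ltW.
have h3 : 0 <= cross x (toR b) * d2 - cross (toR a) x * d1.
  by rewrite cross_pluecker mulr_ge0 // ltW.
have nc' : ~ (0 < c1 /\ 0 < c2).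
  by rewrite /c1 /c2 !cross_toR !ltr0z => -[p q]; rewrite p q in nc.
have nd' : ~ (0 < d1 /\ 0 < d2).
  by rewrite /d1 /d2 !cross_toR !ltr0z => -[p q]; rewrite p q in nd.
have [c1p c2n] := sector_coords xb ax h1 h2 h3 nc' nd'.
(* Reflecting in the diagonal swaps the coordinates and exchanges the roles of c and d. *)
have [d2p d1n] : 0 <= d2 /\ d1 <= 0.
  apply: (@sector_coords R (cross (toR a) x) (cross x (toR b)) d2 d1 c2 c1) => //.
  - by move: h1; rewrite (mulrC c1) (mulrC c2).
  - by move: h3; rewrite !(mulrC _ d1) !(mulrC _ d2).
  - by move: h2; rewrite !(mulrC _ c1) !(mulrC _ c2).
  - by case=> p q; apply: nd'.
  - by case=> p q; apply: nc'.
apply: cone_sub => w; rewrite !inE => /orP[]/eqP->;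
  apply/(cone_crossP _ cd); split=> //.
  by rewrite crossC oppr_ge0.
by rewrite crossC oppr_ge0.
Qed.

Lemma cone2_boundary (R : realType) (a b : 'cV[int]_2) (x : 'cV[R]_2) :
  0 < cross a b -> cone R [:: a; b] x ->
  [\/ 0 < cross (toR a) x /\ 0 < cross x (toR b),
      cone R [:: a] x | cone R [:: b] x].
Proof.
rewrite -(ltr0z R) -cross_toR => ab /cone2P[s [t [s0 t0 ->]]].
rewrite crossDr crossDl !crossZr !crossZl !crossxx !mulr0 add0r addr0.
have [s1|s1|<-] := ltgtP 0 s; last 2 first.
- by move: s0; rewrite leNgt s1.
- by constructor 3; rewrite scale0r add0r; apply/cone1P; exists t.
have [t1|t1|<-] := ltgtP 0 t; last 2 first.
- by move: t0; rewrite leNgt t1.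
- by constructor 2; rewrite scale0r addr0; apply/cone1P; exists s.
by constructor 1; rewrite !mulr_gt0.
Qed.

(** * The fan with a prescribed set of rays *)

(** The pair is ordered counterclockwise and spans less than a straight angle; a wider gap between
    neighbours yields no cone. *)
Definition adjacent (S : seq 'cV[int]_2) (a b : 'cV[int]_2) : bool :=
  [&& a \in S, b \in S, 0 < cross a b
    & all (fun v => ~~ ((0 < cross a v) && (0 < cross v b))) S].

Lemma adjacent_cross S a b : adjacent S a b -> 0 < cross a b.
Proof. by case/and4P. Qed.

Definition fan_of (R : realType) (S : seq 'cV[int]_2) : set (set 'cV[R]_2) :=
  [set sigma | [\/ sigma = cone R [::],
      exists2 v, v \in S & sigma = cone R [:: v]
    | exists a b, adjacent S a b /\ sigma = cone R [:: a; b]]].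
Arguments fan_of R S sigma : clear implicits.

Lemma cone1_strongly_convex (R : realType) v : primitive v ->
  strongly_convex (cone R [:: v]).
Proof.
move=> pv x /cone1P[a a0 ->] /cone1P[b b0 e].
have : (a + b) *: (toR v : 'cV[R]_2) = 0 by rewrite scalerDl -e subrr.
move/eqP; rewrite scaler_eq0 => /orP[|/eqP /toR_eq0 v0]; last first.
  by move: (primitive_neq0 pv); rewrite v0 eqxx.
by rewrite paddr_eq0 // => /andP[/eqP-> _]; rewrite scale0r.
Qed.

Lemma cone2_strongly_convex (R : realType) v w : 0 < cross v w ->
  strongly_convex (cone R [:: v; w]).
Proof.
move=> vw x /(cone_crossP _ vw)[h1 h2] /(cone_crossP _ vw)[].
rewrite crossNl crossNr !oppr_ge0 => h3 h4.
rewrite -(ltr0z R) -cross_toR in vw.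
apply: (scalerI (lt0r_neq0 vw)); rewrite cramer2 scaler0.
have -> : cross x (toR w) = 0 by apply/eqP; rewrite eq_le h4.
have -> : cross (toR v) x = 0 by apply/eqP; rewrite eq_le h3.
by rewrite !scale0r addr0.
Qed.

Section FanOf.
Variables (R : realType) (S : seq 'cV[int]_2).
Hypothesis S_primitive : forall v, v \in S -> primitive v.

(** The generators of [sigma] belong to [S], so none of them is in the open sector of an adjacent
    pair, and [sector_sub] applies. *)
Lemma fan_of_sub a b x sigma : adjacent S a b -> fan_of R S sigma ->
  0 < cross (toR a) x -> 0 < cross x (toR b) -> sigma x ->
  cone R [:: a; b] `<=` sigma.
Proof.
move=> /and4P[_ _ ab /allP adj] [->|[v vS ->]|[c [d [cd ->]]]] ax xb sx.
- by move: sx ax; rewrite cone_nil => ->; rewrite cross0r ltxx.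
- case/negP: (adj _ vS); move: sx ax xb => /cone1P[t t0 ->].
  rewrite crossZr crossZl !cross_toR => h1 h2.
  have t1 : 0 < t.
    by rewrite lt_def t0 andbT; apply: contraTneq h1 => ->; rewrite mul0r ltxx.
  by move: h1 h2; rewrite !(pmulr_rgt0 _ t1) !ltr0z => -> ->.
- case/and4P: cd => cS dS cd _.
  exact: (sector_sub ab cd ax xb sx (adj _ cS) (adj _ dS)).
Qed.

(** A two-dimensional [sigma] whose interior meets [tau] lies in [tau] by [fan_of_sub]. Otherwise
    the intersection is in the two boundary rays, and each of these is contained in [tau] or meets
    it only in 0. *)
Lemma fan_of_inter sigma tau : fan_of R S sigma -> fan_of R S tau ->
  face (sigma `&` tau) sigma.
Proof.
have tau0 tau' : fan_of R S tau' -> tau' 0.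
  by case=> [->|[v _ ->]|[a [b [_ ->]]]]; exact: cone0.
have tauZ tau' a x : fan_of R S tau' -> 0 < a -> tau' (a *: x) -> tau' x.
  by move=> h a0; case: h => [->|[v _ ->]|[p [q [_ ->]]]]; rewrite coneZ_iff.
have coneT tau' v : fan_of R S tau' -> tau' (toR v) -> cone R [:: v] `<=` tau'.
  by case=> [->|[w _ ->]|[a [b [_ ->]]]] h; apply: cone_sub => w';
    rewrite inE => /eqP->.
move=> sF tF; have t0 := tau0 _ tF.
case: (sF) => [->|[v vS ->]|[a [b [adj ->]]]].
- have -> : cone R [::] `&` tau = cone R [::]; last exact: face_refl.
  by rewrite setIidl // cone_nil => x ->.
- have [tv|tv] := pselect (tau (toR v)).
    by rewrite setIidl; [exact: face_refl | exact: coneT].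
  suff -> : cone R [:: v] `&` tau = cone R [::] by exact/cone0_face1/S_primitive.
  rewrite cone_nil; apply/seteqP; split=> x /=; last by move=> ->; split=> //; exact: cone0.
  move=> [/cone1P[t t1 ->] h]; have [->|tn] := eqVneq t 0; first by rewrite scale0r.
  by case: tv; apply: tauZ h => //; rewrite lt_def tn.
have ab := adjacent_cross adj.
have [[x [sx tx ax xb]]|no] :=
    pselect (exists x, [/\ cone R [:: a; b] x, tau x,
                           0 < cross (toR a) x & 0 < cross x (toR b)]).
  by rewrite setIidl; [exact: face_refl | exact: fan_of_sub ax xb tx].
have bd x : cone R [:: a; b] x -> tau x -> cone R [:: a] x \/ cone R [:: b] x.
  move=> sx tx; case: (cone2_boundary ab sx) => [[h1 h2]|h|h]; [|by left|by right].
  by case: no; exists x.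
have gen v : v \in [:: a; b] -> cone R [::v] `<=` cone R [:: a; b].
  by move=> hv; apply: cone_sub => w; rewrite inE => /eqP->; exact: cone_gen.
have ga := gen a (mem_head _ _); have gb : cone R [:: b] `<=` cone R [:: a; b].
  by apply: gen; rewrite !inE eqxx orbT.
have off v x : ~ tau (toR v) -> tau x -> cone R [:: v] x -> x = 0.
  move=> tv tx /cone1P[t t1 e]; have [t2|tn] := eqVneq t 0.
    by rewrite e t2 scale0r.
  by case: tv; apply: (tauZ _ t) => //; [rewrite lt_def tn | rewrite -e].
have [ta|ta] := pselect (tau (toR a)); have [tb|tb] := pselect (tau (toR b)).
(* If [tau] contained both generators, it would contain their sum, an interior point. *)
- case: no; exists (toR a + toR b).
  have abR : 0 < cross (toR a) (toR b) :> R by rewrite cross_toR ltr0z.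
  rewrite crossDr crossDl !crossxx add0r addr0; split=> //.
    by apply: coneD; apply: cone_gen; rewrite !inE eqxx ?orbT.
  by case: tF ta tb => [->|[w _ ->]|[c [d [_ ->]]]]; exact: coneD.
- suff -> : cone R [:: a; b] `&` tau = cone R [:: a] by exact: cone2_face_left.
  apply/seteqP; split=> x; last by move=> h; split; [exact: ga | exact: coneT h].
  case=> sx tx; case: (bd x sx tx) => // h.
  by rewrite (off b x tb tx h); exact: cone0.
- suff -> : cone R [:: a; b] `&` tau = cone R [:: b] by exact: cone2_face_right.
  apply/seteqP; split=> x; last by move=> h; split; [exact: gb | exact: coneT h].
  case=> sx tx; case: (bd x sx tx) => // h.
  by rewrite (off a x ta tx h); exact: cone0.
- suff -> : cone R [:: a; b] `&` tau = cone R [::] by exact: cone0_face2.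
  apply/seteqP; split=> x; last by rewrite cone_nil => ->; split=> //; exact: cone0.
  case=> sx tx; rewrite cone_nil /=.
  by case: (bd x sx tx); [exact: off ta tx | exact: off tb tx].
Qed.

Lemma fan_of_is_fan : is_fan (fan_of R S).
Proof.
split.
- apply: (@sub_finite_set _ _ ([set cone R [::]] `|`
      (fun v => cone R [:: v]) @` [set` S] `|`
      (fun p => cone R [:: p.1; p.2]) @` [set` [seq (a, b) | a <- S, b <- S]])).
    move=> sigma [->|[v vS ->]|[a [b [/and4P[aS bS _ _] ->]]]]; [left; left|left; right|right].
    + by [].
    + by exists v.
    + by exists (a, b) => //=; apply/allpairsP; exists (a, b).
  by rewrite !finite_setU; split; [split|]; try exact: finite_image; exact: finite_set1.
- by move=> sigma [->|[v _ ->]|[a [b [_ ->]]]]; eexists.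
- move=> sigma [->|[v vS ->]|[a [b [/adjacent_cross ab ->]]]].
  + by rewrite cone_nil => x.
  + exact/cone1_strongly_convex/S_primitive.
  + exact: cone2_strongly_convex.
- move=> sigma tau [->|[v vS ->]|[a [b [ab ->]]]].
  + by case/face_cone => p /= ->; constructor 1.
  + by case/face_cone1 => ->; [constructor 1 | constructor 2; exists v].
  + case/and4P: (ab) => aS bS _ _.
    case/face_cone2 => ->; [constructor 1 | constructor 2; exists a
      | constructor 2; exists b | constructor 3; exists a, b] => //.
- move=> sigma tau hs ht; split; first exact: fan_of_inter.
  by rewrite setIC; exact: fan_of_inter.
Qed.

Lemma rays_fan_of : rays (fan_of R S) = [set` S].
Proof.
apply/seteqP; split=> v /=; last first.
  by move=> vS; split; [exact: S_primitive | constructor 2; exists v].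
have gen u s : u \in s -> cone R s (toR u) by exact: cone_gen.
case=> pv [e|[w wS e]|[a [b [/and4P[aS bS ab _] e]]]].
- have : cone R [::] (toR v) by rewrite -e; apply: gen; rewrite mem_head.
  rewrite cone_nil => /toR_eq0 v0.
  by move: (primitive_neq0 pv); rewrite v0 eqxx.
- rewrite (@cone1_inj R v w) //; first exact: S_primitive.
  by rewrite -e; apply: gen; rewrite mem_head.
have av : a = v.
  apply: (@cone1_inj R) => //; first exact: S_primitive.
  by rewrite e; apply: gen; rewrite mem_head.
have bv : b = v.
  apply: (@cone1_inj R) => //; first exact: S_primitive.
  by rewrite e; apply: gen; rewrite !inE eqxx orbT.
by move: ab; rewrite av bv crossxx ltxx.
Qed.

End FanOf.

(** * Comparing complete fans *)

(** Squeeze [sigma] into a cone of [G] and that one into a cone [sigma'] of [F]. Then [sigma] is a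
    face of [sigma'], and the same functional exhibits it as a face of the cone in between. *)
Lemma refines_antisym (R : realType) (F G : set (set 'cV[R]_2)) :
  is_fan F -> is_fan G -> refines F G -> refines G F -> F `<=` G.
Proof.
move=> fF fG [_ FG] [_ GF] sigma Fs.
have [tau Gt st] := FG _ Fs; have [sigma' Fs' ts'] := GF _ Gt.
have [_ [u u0 e]] := fan_inter fF Fs Fs'.
rewrite setIidl in e; last exact: subset_trans ts'.
apply: (fan_face fG Gt); exists u => [x /ts' /u0 //|].
apply/seteqP; split=> x; first by move=> sx; split; [exact: st | move: sx; rewrite e => -[]].
by case=> tx ux; rewrite e; split=> //; exact: ts'.
Qed.

Lemma fan_cone (R : realType) (F : set (set 'cV[R]_2)) sigma :
  is_fan F -> F sigma ->
  [\/ sigma = cone R [::],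
      exists2 v, rays F v & sigma = cone R [:: v]
    | exists v w, [/\ rays F v, rays F w, 0 < cross v w
                    & sigma = cone R [:: v; w]]].
Proof.
move=> fF Fs; have [s es] := fan_polyhedral fF Fs.
have := fan_strongly_convex fF Fs; rewrite es => /strongly_convex_cone.
case=> [->|[v pv e]|[v [w [pv pw vw e]]]]; first by constructor 1.
  by constructor 2; exists v => //; split=> //; rewrite -e -es.
constructor 3; exists v, w; split=> //; split=> //; apply: (fan_face fF Fs); rewrite es e.
  exact: cone2_face_left.
exact: cone2_face_right.
Qed.

(** No ray of [F] runs through the interior of a cone of [G], being itself a ray of [G]. Hence the
    cone of [F] through an interior point contains the whole cone of [G] by [sector_sub]. *)
Lemma complete_fan_refines (R : realType) (F G : set (set 'cV[R]_2)) :
  is_complete_fan F -> is_complete_fan G -> rays F `<=` rays G -> refines G F.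
Proof.
move=> [fF sF] [fG sG] FG; split=> [|tau Gt]; first by rewrite sF sG.
have ex x : exists2 sigma, F sigma & sigma x.
  by have : fan_support F x by rewrite sF.
case: (fan_cone fG Gt) => [->|[v rv ->]|[a [b [ra rb ab e]]]].
- by have [sigma Fs s0] := ex 0; exists sigma => //; rewrite cone_nil => x ->.
- have [sigma Fs s0] := ex (toR v); exists sigma => //.
  have [s es] := fan_polyhedral fF Fs; rewrite es in s0 *.
  by apply: cone_sub => w; rewrite inE => /eqP->.
have abR : 0 < cross (toR a) (toR b) :> R by rewrite cross_toR ltr0z.
have no c : rays F c -> ~~ ((0 < cross a c) && (0 < cross c b)).
  move=> rc; apply/negP => /andP[ac cb]; have [pc Gc] := FG _ rc.
  have [[u u0 eu] _] := fan_inter fG Gt Gc.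
  have tc : tau (toR c) by rewrite e; apply/cone_cross_int => //; rewrite !ltW.
  have cc : cone R [:: c] (toR c) by apply: cone_gen; rewrite mem_head.
  (* Of the four possible faces, the three proper ones miss [c], and the whole cone is not contained
     in the ray of [c]. *)
  have : face (tau `&` cone R [:: c]) (cone R [:: a; b]) by rewrite -e; exists u.
  have tcc : (tau `&` cone R [:: c]) (toR c) by [].
  case/face_cone2 => h; rewrite h in tcc; move: tcc.
  + by rewrite cone_nil => /toR_eq0 c0; rewrite c0 cross0r ltxx in ac.
  + by case/cone1P => t t0 /(congr1 (cross (toR a))); rewrite crossZr crossxx mulr0
      cross_toR => /eqP; rewrite intr_eq0 gt_eqF.
  + case/cone1P => t t0 /(congr1 (fun x => cross x (toR b))).
    by rewrite crossZl crossxx mulr0 cross_toR => /eqP; rewrite intr_eq0 gt_eqF.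
  + move=> _; have : cone R [:: c] (toR a).
      suff : (tau `&` cone R [:: c]) (toR a) by case.
      by rewrite h; apply: cone_gen; rewrite mem_head.
    case/cone1P => t t0 /(congr1 (fun x => cross x (toR c))).
    by rewrite crossZl crossxx mulr0 cross_toR => /eqP; rewrite intr_eq0 gt_eqF.
have [sigma Fs sab] := ex (toR a + toR b); exists sigma => //; rewrite e.
have apos : 0 < cross (toR a) (toR a + toR b) :> R by rewrite crossDr crossxx add0r.
have bpos : 0 < cross (toR a + toR b) (toR b) :> R by rewrite crossDl crossxx addr0.
case: (fan_cone fF Fs) => [es|[c rc es]|[c [d [rc rd cd es]]]]; rewrite es in sab *.
- by move: sab apos; rewrite cone_nil => ->; rewrite cross0r ltxx.
- case/negP: (no _ rc); case/cone1P: sab => t t0 et.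
  move: apos bpos; rewrite et crossZr crossZl !cross_toR => h1 h2.
  have t1 : 0 < t.
    by rewrite lt_def t0 andbT; apply: contraTneq h1 => ->; rewrite mul0r ltxx.
  by move: h1 h2; rewrite !(pmulr_rgt0 _ t1) !ltr0z => -> ->.
- exact: (sector_sub ab cd apos bpos sab (no _ rc) (no _ rd)).
Qed.

Lemma complete_fan_rays_inj (R : realType) (F G : set (set 'cV[R]_2)) :
  is_complete_fan F -> is_complete_fan G -> rays F = rays G -> F = G.
Proof.
move=> cF cG e; have r1 : refines G F by apply: complete_fan_refines; rewrite ?e.
have r2 : refines F G by apply: complete_fan_refines; rewrite ?e.
by case: cF cG => fF _ [fG _]; apply/seteqP; split; exact: refines_antisym.
Qed.

(* Unimodularity makes v a nonnegative integer combination of the generators. *)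
Lemma irreducible_ray (R : realType) (G : set (set 'cV[R]_2)) tau v :
  is_fan G -> nonsingular_fan G -> G tau -> primitive v -> tau (toR v) ->
  (forall p q, tau (toR p) -> tau (toR q) -> v = p + q -> p = 0 \/ q = 0) ->
  rays G v.
Proof.
move=> fG nG Gt pv tv irr.
case: (fan_cone fG Gt) => [e|[w rw e]|[a [b [ra rb ab e]]]].
- move: tv; rewrite e cone_nil => /toR_eq0 v0.
  by move: (primitive_neq0 pv); rewrite v0 eqxx.
- by rewrite (@cone1_inj R v w) // -?e; case: rw.
have [pa _] := ra; have [pb _] := rb.
have ab1 : cross a b = 1.
  have := nG _ Gt a b pa pb; rewrite det2E gt_eqF // => /(_ isT e).
  by rewrite gtr0_norm.
move: (tv); rewrite e cone_cross_int // => -[av vb].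
have ev : v = cross v b *: a + cross a v *: b by rewrite -cramer2 ab1 scale1r.
have tZ s w : 0 <= s -> w \in [:: a; b] -> tau (toR (s *: w)).
  by move=> s0 hw; rewrite e toRZ; apply: coneZ; rewrite ?ler0z //; exact: cone_gen.
have ray w s : rays G w -> 0 <= s -> v = s *: w -> rays G v.
  move=> rw s0 es; rewrite (@cone1_inj R v w) //; first by case: rw.
  by apply/cone1P; exists s%:~R; rewrite ?ler0z // es toRZ.
have := irr _ _ (tZ _ a vb (mem_head _ _)) (tZ _ b av _) ev.
rewrite !inE eqxx orbT => /(_ isT)[h|h]; rewrite h ?add0r ?addr0 in ev.
  exact: ray rb av ev.
exact: ray ra vb ev.
Qed.

(** * The fan of the desingularization *)

(** Listed counterclockwise, so that cyclically consecutive entries span the maximal cones. *)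
Definition desing_rays (k : nat) : seq 'cV[int]_2 :=
  [:: vec2 1 0; vec2 0 1; vec2 (- 1) (- k%:Z);
      vec2 (- 2) (- (2 * k%:Z + 1));
      vec2 (- 1) (- (k%:Z + 1)); vec2 0 (- 1)].

(** The generators of each maximal cone are put in counterclockwise order, as [cone_crossP]
    requires. *)
Definition wps_sectors (k : nat) : seq ('cV[int]_2 * 'cV[int]_2) :=
  let u := vec2 (- 2) (- (2 * k%:Z + 1)) in
  [:: (vec2 1 0, vec2 0 1); (vec2 0 1, u); (u, vec2 1 0)].

Lemma cross_vec2 a b c d : cross (vec2 a b) (vec2 c d) = a * d - b * c.
Proof. by rewrite /cross !mxE. Qed.

Lemma vec2_eta (v : 'cV[int]_2) : v = vec2 (v 0 0) (v 1 0).
Proof. by apply: colv2P; rewrite !mxE. Qed.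

Lemma wps_sectors_cross k p : p \in wps_sectors k -> 0 < cross p.1 p.2.
Proof. by rewrite !inE => /or3P[] /eqP->; rewrite cross_vec2; lia. Qed.

Lemma wps_maxcone_sector (R : realType) k (sigma : set 'cV[R]_2) :
  (exists i, sigma = wps_maxcone R 2 (2 * k + 1) i) <->
  (exists2 p, p \in wps_sectors k & sigma = cone R [:: p.1; p.2]).
Proof.
have enum3 : enum 'I_3 = [:: Ordinal (isT : 0 < 3)%N; Ordinal (isT : 1 < 3)%N;
                             Ordinal (isT : 2 < 3)%N].
  by apply: (inj_map val_inj); rewrite val_enum_ord.
have u0 : vec2 (- 2%:Z) (- (2 * k + 1)%N%:Z) = vec2 (- 2) (- (2 * k%:Z + 1)).
  by rewrite PoszD PoszM.
split=> [[[[|[|[|//]]] hi] ->]|[p + ->]].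
- exists (vec2 1 0, vec2 0 1); first by rewrite !inE eqxx.
  by rewrite /wps_maxcone enum3.
- exists (vec2 0 1, vec2 (- 2) (- (2 * k%:Z + 1))); first by rewrite !inE eqxx orbT.
  by rewrite /wps_maxcone enum3 /= /wps_ray /= u0 cone2C.
- exists (vec2 (- 2) (- (2 * k%:Z + 1)), vec2 1 0); first by rewrite !inE eqxx !orbT.
  by rewrite /wps_maxcone enum3 /= /wps_ray /= u0.
rewrite !inE => /or3P[] /eqP->.
- by exists (Ordinal (isT : 0 < 3)%N); rewrite /wps_maxcone enum3.
- exists (Ordinal (isT : 1 < 3)%N).
  by rewrite /wps_maxcone enum3 /= /wps_ray /= u0 cone2C.
- by exists (Ordinal (isT : 2 < 3)%N); rewrite /wps_maxcone enum3 /= /wps_ray /= u0.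
Qed.

Lemma wps_fan_sector (R : realType) k (sigma : set 'cV[R]_2) :
  wps_fan R 2 (2 * k + 1) sigma ->
  exists2 p, p \in wps_sectors k & sigma `<=` cone R [:: p.1; p.2].
Proof.
case=> i /face_sub; have [+ _] := wps_maxcone_sector k (wps_maxcone R 2 (2 * k + 1) i).
by case=> [|p pk ->]; [exists i | exists p].
Qed.

Lemma sector_wps_fan (R : realType) k p : p \in wps_sectors k ->
  wps_fan R 2 (2 * k + 1) (cone R [:: p.1; p.2]).
Proof.
move=> pk; have [_ []] := wps_maxcone_sector k (cone R [:: p.1; p.2]).
  by exists p.
by move=> i ->; exists i; exact: face_refl.
Qed.

(** * The six rays and the cones between neighbours *)

Lemma desing_rays_primitive k v : v \in desing_rays k -> primitive v.
Proof.
move=> hv; apply/primitiveP; move: hv; rewrite !inE.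
move=> /orP[/eqP->|/orP[/eqP->|/orP[/eqP->|/orP[/eqP->|/orP[/eqP->|/eqP->]]]]].
- by exists (vec2 0 1); rewrite cross_vec2; lia.
- by exists (vec2 (- 1) 0); rewrite cross_vec2; lia.
- by exists (vec2 (- 2) (- (2 * k%:Z + 1))); rewrite cross_vec2; lia.
- by exists (vec2 (- 1) (- (k%:Z + 1))); rewrite cross_vec2; lia.
- by exists (vec2 0 (- 1)); rewrite cross_vec2; lia.
- by exists (vec2 1 0); rewrite cross_vec2; lia.
Qed.

(** Zipping with the rotation by one pairs every vector with its successor, and the last with the
    first. *)
Lemma desing_rays_adjacent k :
  all (fun p => adjacent (desing_rays k) p.1 p.2)
    (zip (desing_rays k) (rot 1 (desing_rays k))).
Proof.
rewrite /= /rot /= /adjacent !inE !eqxx ?orbT /= !cross_vec2.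
lia.
Qed.

Lemma desing_raysP k v :
  v \in desing_rays k -> exists2 i, (i < 6)%N & v = (desing_rays k)`_i.
Proof.
by move=> hv; exists (index v (desing_rays k)); rewrite ?nth_index // index_mem.
Qed.

Lemma adjacent_desing_rays k a b : adjacent (desing_rays k) a b ->
  cross a b = 1 /\ exists2 p, p \in wps_sectors k &
    [/\ 0 <= cross p.1 a, 0 <= cross a p.2, 0 <= cross p.1 b & 0 <= cross b p.2].
Proof.
(* With the boolean [has] in place of the existential, each of the 36 pairs of indices becomes a
   question of linear arithmetic. *)
suff: adjacent (desing_rays k) a b -> cross a b = 1 /\
    has (fun p => [&& 0 <= cross p.1 a, 0 <= cross a p.2, 0 <= cross p.1 b
                    & 0 <= cross b p.2]) (wps_sectors k).
  by move=> h /h[-> /hasP[p pk /and4P h']]; split=> //; exists p.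
case/and4P.
move=> /desing_raysP[[|[|[|[|[|[|//]]]]]] _ ->] /desing_raysP[[|[|[|[|[|[|//]]]]]] _ ->];
  rewrite /= !cross_vec2; lia.
Qed.

Lemma desing_fan_complete (R : realType) k :
  is_complete_fan (fan_of R (desing_rays k)).
Proof.
split; first exact/fan_of_is_fan/desing_rays_primitive.
apply/seteqP; split=> // x _.
have cov a b : (a, b) \in zip (desing_rays k) (rot 1 (desing_rays k)) ->
    0 <= cross (toR a) x -> cross (toR b) x <= 0 ->
    fan_support (fan_of R (desing_rays k)) x.
  move=> /(allP (desing_rays_adjacent k)) adj h1 h2.
  exists (cone R [:: a; b]); first by constructor 3; exists a, b.
  by rewrite cone_crossP ?(adjacent_cross adj) // (crossC x) oppr_ge0.
have cE (a b : int) : cross (toR (vec2 a b)) x = a%:~R * x 1 0 - b%:~R * x 0 0.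
  by rewrite /cross !mxE.
(* Two cones cover the right half-plane. In the left one, the rays after (0, 1) are tried in
   counterclockwise order, and the first that [x] has not passed closes the cone containing [x]. *)
have [x0|x0] := leP 0 (x 0 0).
  have [y0|y0] := leP 0 (x 1 0).
    apply: (cov (vec2 1 0) (vec2 0 1)); rewrite ?inE ?eqxx // cE; lra.
  apply: (cov (vec2 0 (- 1)) (vec2 1 0)); rewrite ?inE ?eqxx ?orbT // cE; lra.
have [h2|h2] := leP (cross (toR (vec2 (- 1) (- k%:Z))) x) 0.
  apply: (cov (vec2 0 1) _ _ _ h2); first by rewrite !inE eqxx ?orbT.
  by rewrite cE; lra.
have [h3|h3] := leP (cross (toR (vec2 (- 2) (- (2 * k%:Z + 1)))) x) 0.
  by apply: (cov _ _ _ (ltW h2) h3); rewrite !inE eqxx ?orbT.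
have [h4|h4] := leP (cross (toR (vec2 (- 1) (- (k%:Z + 1)))) x) 0.
  by apply: (cov _ _ _ (ltW h3) h4); rewrite !inE eqxx ?orbT.
apply: (cov _ (vec2 0 (- 1)) _ (ltW h4)); first by rewrite !inE eqxx ?orbT.
by rewrite cE; lra.
Qed.

Lemma desing_fan_sector (R : realType) k (sigma : set 'cV[R]_2) :
  fan_of R (desing_rays k) sigma ->
  exists2 p, p \in wps_sectors k & sigma `<=` cone R [:: p.1; p.2].
Proof.
(* Every cone of the fan lies in a two-dimensional one, a ray in the cone that it spans with its
   successor. *)
move=> Fs; suff [a [b [adj sab]]] : exists a b,
    adjacent (desing_rays k) a b /\ sigma `<=` cone R [:: a; b].
  have [_ [p pk [h1 h2 h3 h4]]] := adjacent_desing_rays adj.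
  exists p => //; apply: subset_trans sab _; apply: cone_sub => v.
  have p0 : 0 < cross p.1 p.2 by exact: wps_sectors_cross pk.
  by rewrite !inE => /orP[]/eqP->; rewrite cone_cross_int.
have adj i : (i < 6)%N -> exists b, adjacent (desing_rays k) (desing_rays k)`_i b.
  move=> i6; exists (rot 1 (desing_rays k))`_i.
  have /all_nthP-/(_ (0, 0) i) := desing_rays_adjacent k.
  by move=> /(_ i6); rewrite nth_zip.
case: Fs => [->|[v vL ->]|[a [b [ab ->]]]]; last by exists a, b; split.
  have [b ab] := adj 0 isT; exists (desing_rays k)`_0, b; split=> //.
  by rewrite cone_nil => x ->; exact: cone0.
have iL : (index v (desing_rays k) < 6)%N by rewrite (index_mem v (desing_rays k)).
have [b] := adj _ iL; rewrite nth_index // => vb.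
exists v, b; split=> //; apply: cone_sub => w; rewrite inE => /eqP->.
by apply: cone_gen; rewrite mem_head.
Qed.

(** Read off the finer fan, whose cones cover the plane and each lie in a maximal cone of the
    original one. *)
Lemma wps_fan_support (R : realType) k :
  fan_support (wps_fan R 2 (2 * k + 1)) = setT.
Proof.
apply/seteqP; split=> // x _; have [_ sF] := desing_fan_complete R k.
have : fan_support (fan_of R (desing_rays k)) x by rewrite sF.
case=> sigma /desing_fan_sector[p pk sp] /sp hx.
by exists (cone R [:: p.1; p.2]) => //; exact: sector_wps_fan.
Qed.

(* The shear y = k x + u makes all constraints except y <= 0 linear in (x, u). *)
Lemma desing_rays_irreducible k (hk : (1 <= k)%N) s v p q :
  s \in wps_sectors k -> v \in desing_rays k ->
  0 <= cross s.1 p -> 0 <= cross p s.2 -> 0 <= cross s.1 q -> 0 <= cross q s.2 ->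
  v = p + q -> p = 0 \/ q = 0.
Proof.
move=> hs /desing_raysP[i i6 ->] h1 h2 h3 h4 e.
have e0 : (desing_rays k)`_i 0 0 = p 0 0 + q 0 0 by rewrite e mxE.
have e1 : (desing_rays k)`_i 1 0 = p 1 0 + q 1 0 by rewrite e mxE.
suff : p 0 0 = 0 /\ p 1 0 = 0 \/ q 0 0 = 0 /\ q 1 0 = 0.
  by case=> -[h h']; [left | right]; apply: colv2P; rewrite !mxE.
move: h1 h2 h3 h4 e0 e1 {e}; rewrite (vec2_eta p) (vec2_eta q) !mxE /=.
move: (p 0 0) (p 1 0) (q 0 0) (q 1 0) => x y z t h1 h2 h3 h4 e0 e1.
have [u eu] : exists u, y = k%:Z * x + u by exists (y - k%:Z * x); ring.
have z0 : z = (desing_rays k)`_i 0 0 - x by rewrite e0; ring.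
have t0 : t = (desing_rays k)`_i 1 0 - y by rewrite e1; ring.
subst z t y; move: h1 h2 h3 h4 {e0 e1}.
move: hs; rewrite !inE => /or3P[] /eqP->;
move: i i6 => [|[|[|[|[|[|//]]]]]] _; rewrite /= !cross_vec2 !mxE /= => h1 h2 h3 h4.
all: try lia.
all: try nia.
(* In the sector from (0, 1) to (-2, -(2k+1)), neither summand has a positive first coordinate,
   which leaves finitely many [x]. *)
- have [e|e] : x = 0 \/ x = - 1 by lia.
    by subst x; lia.
  by subst x; lia.
- have [e|[e|e]] : x = 0 \/ x = - 1 \/ x = - 2 by lia.
  + by subst x; lia.
  + by subst x; lia.
  + by subst x; lia.
(* In the sector from (-2, -(2k+1)) to (1, 0), the form x - 2u is nonnegative on both summands. Its
   total is 0 for (-2, -(2k+1)) and 1 for (-1, -(k+1)), which ties [x] to [u]; nonpositivity of the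
   second coordinates then fixes the few values of [u]. *)
- have ex : x = 2 * u by lia.
  have [e|e] : u = 0 \/ u = - 1 by subst x; nia.
    by subst u x; lia.
  by subst u x; lia.
- have [ex|ex] : x = 2 * u \/ x = 2 * u + 1 by lia.
    have e : u = 0 by subst x; nia.
    by subst u x; lia.
  have e : u = - 1 by subst x; nia.
  by subst u x; lia.
Qed.

(** By [cone2_inj], any two primitive generators of a two-dimensional cone are the adjacent pair up
    to order, and that pair has determinant 1. *)
Lemma desing_fan_nonsingular (R : realType) k :
  nonsingular_fan (fan_of R (desing_rays k)).
Proof.
move=> sigma Fs v w pv pw.
have sv : sigma = cone R [:: v; w] -> sigma (toR v) /\ sigma (toR w).
  by move=> ->; split; apply: cone_gen; rewrite !inE eqxx ?orbT.
rewrite det2E => vw e; have [{}sv sw] := sv e.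
case: Fs => [es|[u uL es]|[a [b [adj es]]]].
- move: sv; rewrite es cone_nil => /toR_eq0 v0.
  by move: (primitive_neq0 pv); rewrite v0 eqxx.
- have pu := desing_rays_primitive uL; rewrite es in sv sw.
  by move: vw; rewrite (cone1_inj pv pu sv) (cone1_inj pw pu sw) crossxx eqxx.
have ab := adjacent_cross adj; have [ab1 _] := adjacent_desing_rays adj.
case/and4P: adj => /desing_rays_primitive pa /desing_rays_primitive pb _ _.
move: vw; rewrite neq_lt => /orP[vw|vw]; last first.
  by have [<- <-] := cone2_inj pa pb pv pw ab vw (etrans (esym es) e); rewrite ab1.
have wv : 0 < cross w v by rewrite crossC oppr_gt0.
rewrite cone2C in e.
have [<- <-] := cone2_inj pa pb pw pv ab wv (etrans (esym es) e).
by rewrite crossC normrN ab1.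
Qed.

(** * Desingularization and minimality *)

Lemma desing_fan_desingularization (R : realType) k :
  is_desingularization (wps_fan R 2 (2 * k + 1)) (fan_of R (desing_rays k)).
Proof.
split; [exact/fan_of_is_fan/desing_rays_primitive| |exact: desing_fan_nonsingular].
split; first by rewrite wps_fan_support; case: (desing_fan_complete R k).
move=> tau /desing_fan_sector[p pk sp].
by exists (cone R [:: p.1; p.2]) => //; exact: sector_wps_fan.
Qed.

Lemma desingularization_complete (R : realType) k (G : set (set 'cV[R]_2)) :
  is_desingularization (wps_fan R 2 (2 * k + 1)) G -> is_complete_fan G.
Proof. by case=> fG [sG _] _; split=> //; rewrite sG wps_fan_support. Qed.

(** Some cone of [G] contains the vector and lies in a maximal cone of the original fan.
    Irreducibility there passes to the smaller cone, and [irreducible_ray] applies. *)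
Lemma desing_rays_sub (R : realType) k (hk : (1 <= k)%N) (G : set (set 'cV[R]_2)) :
  is_desingularization (wps_fan R 2 (2 * k + 1)) G ->
  [set` desing_rays k] `<=` rays G.
Proof.
move=> dG v /= vL; have [_ sG] := desingularization_complete dG.
have [fG [_ rG] nG] := dG.
have [tau Gt tv] : fan_support G (toR v) by rewrite sG.
have [sigma /wps_fan_sector[p pk sp] ts] := rG _ Gt.
apply: (irreducible_ray fG nG Gt (desing_rays_primitive vL) tv) => a b ta tb.
have p0 := wps_sectors_cross pk.
have /(cone_cross_int R _ p0)[a1 a2] := sp _ (ts _ ta).
have /(cone_cross_int R _ p0)[b1 b2] := sp _ (ts _ tb).
exact: (desing_rays_irreducible hk pk vL a1 a2 b1 b2).
Qed.

(** Both the coarsest-refinement and the fewest-rays clause follow from the inclusion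
    [desing_rays_sub]. *)
Lemma desing_fan_minimal (R : realType) k : (1 <= k)%N ->
  is_minimal_desingularization (wps_fan R 2 (2 * k + 1)) (fan_of R (desing_rays k)).
Proof.
move=> hk; have rF := rays_fan_of R (@desing_rays_primitive k).
split; first exact: desing_fan_desingularization.
  move=> G dG; apply: complete_fan_refines; first exact: desing_fan_complete.
    exact: desingularization_complete dG.
  by rewrite rF; exact: desing_rays_sub dG.
move=> G dG; apply: subset_card_le.
by rewrite rF; exact: desing_rays_sub dG.
Qed.

Theorem theorem5p1 (R : realType) (k : nat) (hk : (1 <= k)%N) :
  (exists F, is_minimal_desingularization (wps_fan R 2 (2 * k + 1)) F) /\
  (forall F : set (set 'cV[R]_2),
    is_minimal_desingularization (wps_fan R 2 (2 * k + 1)) F <->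
    is_complete_fan F /\
    rays F = [set` [:: vec2 1 0; vec2 0 1; vec2 (- 1) (- k%:Z);
                       vec2 (- 2) (- (2 * k%:Z + 1));
                       vec2 (- 1) (- (k%:Z + 1)); vec2 0 (- 1)]]).
Proof.
have mF := desing_fan_minimal R hk; have cF := desing_fan_complete R k.
have rF := rays_fan_of R (@desing_rays_primitive k).
split; first by exists (fan_of R (desing_rays k)).
rewrite -/(desing_rays k) => F; split=> [[dF minF _]|[cF' rF']]; last first.
  by have <- : fan_of R (desing_rays k) = F by apply: complete_fan_rays_inj; rewrite ?rF'.
(* Two minimal desingularizations refine each other, so [refines_antisym] identifies them. *)
suff -> : F = fan_of R (desing_rays k) by [].
have [dF0 minF0 _] := mF; have [fF0 _] := cF; have [fF _ _] := dF.
by apply/seteqP; split; apply: refines_antisym => //;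
  solve [exact: minF0 | exact: minF].
Qed.
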